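(* Let $M$ be a closed term. Then $\mathcal{E}(M)=\sup\{w\mid \vdash^{w}M:\mathbf{0}\text{ is derivable}\}$, and $M$ is positively almost surely terminating (i.e. $\mathcal{E}(M)<\infty$) if and only if $\sup\{w\mid \vdash^{w}M:\mathbf{0}\text{ is derivable}\}<\infty$.
   Context: Terms: values $V ::= x \mid \lambda x.M$; terms $M ::= V \mid VV \mid M\oplus M \mid \mathtt{let}\ x = M\ \mathtt{in}\ M$; $M\{V/x\}$ is capture-avoiding substitution. A multidistribution on terms is a finite multiset $\langle p_iM_i\rangle_{i\in I}$ with $p_i\in(0,1]$, $\sum_ip_i\le1$; $\sqcup$ is multiset union and $q\cdot\langle p_iM_i\rangle=\langle (qp_i)M_i\rangle$. One-step reduction: $(\lambda x.M)V\to\langle 1\,M\{V/x\}\rangle$; $\mathtt{let}\ x=V\ \mathtt{in}\ M\to\langle 1\,M\{V/x\}\rangle$; $M\oplus N\to\langle\tfrac12 M,\tfrac12 N\rangle$; if $N\to\langle p_iN_i\rangle_{i\in I}$ then $\mathtt{let}\ x=N\ \mathtt{in}\ M\to\langle p_i(\mathtt{let}\ x=N_i\ \mathtt{in}\ M)\rangle_{i\in I}$. Lifting to multidistributions of closed terms: $\langle p_iM_i\rangle_{i\in I}\Rightarrow\bigsqcup_i p_i\cdot\mathbf{m}_i$ where $\mathbf{m}_i=\langle 1M_i\rangle$ if $M_i$ is a value and $M_i\to\mathbf{m}_i$ otherwise. For closed $M$ let $\langle 1M\rangle=\mathbf{m}_0\Rightarrow\mathbf{m}_1\Rightarrow\cdots$;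 $\mathcal{P}_k(M)$ is the sum of the probabilities of the values occurring in $\mathbf{m}_k$; $\mathcal{E}_k(M)=\sum_{j=0}^{k-1}(1-\mathcal{P}_j(M))$ and $\mathcal{E}(M)=\sup_k\mathcal{E}_k(M)$ (possibly $\infty$). Types: arrow types $\mathtt{A} ::= \mathcal{M}\to \mathtt{a}$; intersection types $\mathcal{M} ::= [q_1\cdot \mathtt{A}_1,\dots,q_n\cdot\mathtt{A}_n]$ ($n\ge0$, scale factors $q_i\in(0,1]\cap\mathbb{Q}$); type distributions $\mathtt{a} ::= \langle p_1\mathcal{M}_1,\dots,p_n\mathcal{M}_n\rangle$ ($n\ge0$, $p_i\in(0,1]$, $\sum p_i\le1$); $\mathbf{0}$ is the empty type distribution. Scaling: $u\cdot[q_i\cdot\mathtt{A}_i]_i=[(uq_i)\cdot \mathtt{A}_i]_i$, $u\cdot\langle p_i\mathcal{M}_i\rangle_i=\langle (up_i)\mathcal{M}_i\rangle_i$; $\uplus,\sqcup$ multiset unions. Typing contexts map variables to intersection types (finitely many nonempty), pointwise $\uplus$ and scaling. Rules for $\Gamma\vdash^{w}M:\tau$ ($w\in\mathbb{Q}$): (Var) $x:\mathcal{M}\vdash^0 x:\mathcal{M}$. (Zero) $\vdash^0 M:\mathbf{0}$. (@) from $\Gamma\vdash^{w}V:[1\cdot(\mathcal{M}\to\mathtt{b})]$, $\Delta\vdash^{v}W:\mathcal{M}$ infer $\Gamma\uplus\Delta\vdash^{w+v}VW:\mathtt{b}$. ($\oplus$) from $\Gamma\vdash^{w}M:\mathtt{a}$,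 $\Delta\vdash^{v}N:\mathtt{b}$ infer $\tfrac12\cdot\Gamma\uplus\tfrac12\cdot\Delta\vdash^{\frac12 w+\frac12 v+1}M\oplus N:\tfrac12\mathtt{a}\sqcup\tfrac12\mathtt{b}$. ($\lambda$) from $\Gamma,x:\mathcal{M}\vdash^{w}M:\mathtt{b}$ infer $\Gamma\vdash^{w+1}\lambda x.M:\mathcal{M}\to\mathtt{b}$. (let) from $\Gamma\vdash^{v}N:\langle p_k\mathcal{M}_k\rangle_{k\in K}$ and $\Delta_k,x:\mathcal{M}_k\vdash^{w_k}M:\mathtt{b}_k$ ($k\in K$) infer $\Gamma\uplus_{k}p_k\cdot\Delta_k\vdash^{\sum_k p_kw_k+v+1}\mathtt{let}\ x=N\ \mathtt{in}\ M:\bigsqcup_k p_k\mathtt{b}_k$. (Val) from $\Gamma\vdash^{w}V:\mathcal{M}$ infer $\Gamma\vdash^{w}V:\langle 1\mathcal{M}\rangle$. (!) for finite possibly empty $I$, from $\Gamma_i\vdash^{w_i}V:\mathtt{A}_i$ and scale factors $q_i$ infer $\uplus_i q_i\cdot\Gamma_i\vdash^{\sum_i q_iw_i}V:[q_i\cdot\mathtt{A}_i]_{i\in I}$. *)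

(* Defs.v *)
From mathcomp Require Import all_boot all_order all_algebra.
From mathcomp Require Import boolp classical_sets reals constructive_ereal ereal.

Set Implicit Arguments.
Unset Strict Implicit.
Unset Printing Implicit Defensive.

Import Order.TTheory GRing.Theory Num.Theory.
Local Open Scope ring_scope.

(** * Terms

    Terms are in de Bruijn notation: in [Lam M] and in [Let N M]
    (let x = N in M), index 0 of [M] is the bound variable. *)

Inductive value : Type :=
| Var (n : nat)
| Lam (M : term)
with term : Type :=
| Ret (V : value)
| App (V W : value)
| Oplus (M N : term)
| Let (N M : term).

Definition up_ren (r : nat -> nat) (n : nat) : nat :=
  if n is m.+1 then (r m).+1 else 0%N.

Fixpoint ren_value (r : nat -> nat) (V : value) : value :=
  match V with
  | Var n => Var (r n)
  | Lam M => Lam (ren_term (up_ren r) M)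
  end
with ren_term (r : nat -> nat) (M : term) : term :=
  match M with
  | Ret V => Ret (ren_value r V)
  | App V W => App (ren_value r V) (ren_value r W)
  | Oplus M1 M2 => Oplus (ren_term r M1) (ren_term r M2)
  | Let N M1 => Let (ren_term r N) (ren_term (up_ren r) M1)
  end.

Definition up_subst (s : nat -> value) (n : nat) : value :=
  if n is m.+1 then ren_value succn (s m) else Var 0.

Fixpoint subst_value (s : nat -> value) (V : value) : value :=
  match V with
  | Var n => s n
  | Lam M => Lam (subst_term (up_subst s) M)
  end
with subst_term (s : nat -> value) (M : term) : term :=
  match M with
  | Ret V => Ret (subst_value s V)
  | App V W => App (subst_value s V) (subst_value s W)
  | Oplus M1 M2 => Oplus (subst_term s M1) (subst_term s M2)
  | Let N M1 => Let (subst_term s N) (subst_term (up_subst s) M1)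
  end.

(* M{V/x}, where x is index 0 of M; the other indices are decremented. *)
Definition subst0 (V : value) (M : term) : term :=
  subst_term (fun n => if n is m.+1 then Var m else V) M.

(* All free indices are smaller than n. *)
Fixpoint bounded_value (n : nat) (V : value) : bool :=
  match V with
  | Var m => (m < n)%N
  | Lam M => bounded_term n.+1 M
  end
with bounded_term (n : nat) (M : term) : bool :=
  match M with
  | Ret V => bounded_value n V
  | App V W => bounded_value n V && bounded_value n W
  | Oplus M1 M2 => bounded_term n M1 && bounded_term n M2
  | Let N M1 => bounded_term n N && bounded_term n.+1 M1
  end.

Definition closed_term (M : term) : bool := bounded_term 0 M.

Definition is_value (M : term) : bool := if M is Ret _ then true else false.

(** * Finite multisets with rational coefficients

    A finite multiset of weighted elements is represented by a list of pairs
    (coefficient, element).  For multidistributions of terms the order of the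
    list is immaterial because only sums of probabilities are observed; for
    types, lists are identified up to permutation by [eq_arrow] below.
    Multiset union is list concatenation. *)

Definition wseq (T : Type) : Type := seq (rat * T).

Definition scale (T : Type) (u : rat) (s : wseq T) : wseq T :=
  [seq (u * x.1, x.2) | x <- s].

Definition map_wseq (T U : Type) (f : T -> U) (s : wseq T) : wseq U :=
  [seq (x.1, f x.2) | x <- s].

(** * Reduction *)

(* One-step reduction is deterministic, hence given as a partial function;
   [None] means that no rule applies (the term is a value or is stuck on a
   free variable). *)
Fixpoint reduct (M : term) : option (wseq term) :=
  match M with
  | Ret _ => None
  | App (Lam M1) V => Some [:: (1, subst0 V M1)]
  | App (Var _) _ => None
  | Oplus M1 M2 => Some [:: (2^-1, M1); (2^-1, M2)]
  | Let (Ret V) M1 => Some [:: (1, subst0 V M1)]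
  | Let N M1 => omap (map_wseq (fun N' => Let N' M1)) (reduct N)
  end.

(* Closed terms without a reduct are values, so on closed terms the default
   is used exactly for values. *)
Definition lift_term (M : term) : wseq term :=
  if reduct M is Some m then m else [:: (1, M)].

Definition lift_mdist (m : wseq term) : wseq term :=
  flatten [seq scale x.1 (lift_term x.2) | x <- m].

Definition mdist_at (M : term) (k : nat) : wseq term :=
  iter k lift_mdist [:: (1, M)].

Definition Pk (k : nat) (M : term) : rat :=
  \sum_(x <- mdist_at M k | is_value x.2) x.1.

Definition Ek (k : nat) (M : term) : rat :=
  \sum_(j < k) (1 - Pk j M).

Definition expected_time (R : realType) (M : term) : \bar R :=
  ereal_sup (range (fun k : nat => (ratr (Ek k M) : R)%:E)).

Definition PAST (R : realType) (M : term) : Prop :=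
  (expected_time R M < +oo)%E.

(** * Types *)

Inductive arrow : Type :=
| Arr (m : seq (rat * arrow)) (a : seq (rat * seq (rat * arrow))).

Definition inter : Type := wseq arrow.
Definition tydist : Type := wseq inter.

Definition unit_coef (q : rat) : bool := 0 < q <= 1.

(* Scale factors and probabilities lie in (0,1], and the probabilities of a
   type distribution sum up to at most 1, hereditarily. *)
Fixpoint wf_arrow (A : arrow) : bool :=
  let: Arr m a := A in
  [&& all (fun qB : rat * arrow =>
             let: (q, B) := qB in unit_coef q && wf_arrow B) m,
      all (fun pn : rat * seq (rat * arrow) =>
             let: (p, n) := pn in unit_coef p &&
             all (fun qB : rat * arrow =>
                    let: (q, B) := qB in unit_coef q && wf_arrow B) n) a
    & \sum_(pn <- a) pn.1 <= 1].

Definition wf_inter (m : inter) : bool :=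
  all (fun qB => unit_coef qB.1 && wf_arrow qB.2) m.

(* Equality of finite multisets over elements identified by [E]. *)
Inductive eq_wseq (T : Type) (E : T -> T -> Prop) : wseq T -> wseq T -> Prop :=
| eq_wseq_nil : eq_wseq E [::] [::]
| eq_wseq_cons q A B s t :
    E A B -> eq_wseq E s t -> eq_wseq E ((q, A) :: s) ((q, B) :: t)
| eq_wseq_swap x y s : eq_wseq E [:: x, y & s] [:: y, x & s]
| eq_wseq_trans s t u : eq_wseq E s t -> eq_wseq E t u -> eq_wseq E s u.

(* Equality of types, the brackets being read as multisets at every depth. *)
Inductive eq_arrow : arrow -> arrow -> Prop :=
| eq_Arr m n a b :
    eq_wseq eq_arrow m n -> eq_wseq (eq_wseq eq_arrow) a b ->
    eq_arrow (Arr m a) (Arr n b).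

Definition eq_inter : inter -> inter -> Prop := eq_wseq eq_arrow.
Definition eq_tydist : tydist -> tydist -> Prop := eq_wseq eq_inter.

(** * Typing contexts *)

(* The contexts of derivable judgments have finite support, since they are
   built from single bindings by finite sums. *)
Definition ctx : Type := nat -> inter.

Definition ctx0 : ctx := fun _ => [::].
Definition ctx1 (x : nat) (m : inter) : ctx :=
  fun y => if y == x then m else [::].
Definition ctx_cons (m : inter) (G : ctx) : ctx :=
  fun y => if y is z.+1 then G z else m.
Definition ctx_add (G D : ctx) : ctx := fun y => G y ++ D y.
Definition ctx_scale (u : rat) (G : ctx) : ctx := fun y => scale u (G y).
Definition ctx_sum (n : nat) (D : 'I_n -> ctx) : ctx :=
  fun y => \big[cat/[::]]_(k < n) D k y.
Definition ctx_eq (G D : ctx) : Prop := forall y, eq_inter (G y) (D y).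

(** * Typing

    [ty_arrow G w V A], [ty_inter G w V m] and [ty_dist G w M a] are the three
    forms of the judgment G |-^w M : tau, for tau an arrow type, an
    intersection type and a type distribution.  The [_eq] rules only express
    that types and contexts are identified by multiset equality.
    Well-formedness of types is required where types and scale factors are
    introduced (T_Var and T_Bang); all other rules preserve it. *)

Inductive ty_arrow : ctx -> rat -> value -> arrow -> Prop :=
| T_Lam G w M m b :
    ty_dist (ctx_cons m G) w M b ->
    ty_arrow G (w + 1) (Lam M) (Arr m b)
| T_arrow_eq G D w V A B :
    ty_arrow G w V A -> ctx_eq G D -> eq_arrow A B -> ty_arrow D w V B

with ty_inter : ctx -> rat -> value -> inter -> Prop :=
| T_Var x m :
    wf_inter m -> ty_inter (ctx1 x m) 0 (Var x) m
| T_Bang n (G : 'I_n -> ctx) (w q : 'I_n -> rat) V (A : 'I_n -> arrow) :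
    (forall i, unit_coef (q i)) ->
    (forall i, ty_arrow (G i) (w i) V (A i)) ->
    ty_inter (ctx_sum (fun i => ctx_scale (q i) (G i)))
             (\sum_(i < n) q i * w i) V
             [seq (q i, A i) | i <- enum 'I_n]
| T_inter_eq G D w V m n :
    ty_inter G w V m -> ctx_eq G D -> eq_inter m n -> ty_inter D w V n

with ty_dist : ctx -> rat -> term -> tydist -> Prop :=
| T_Zero M :
    ty_dist ctx0 0 M [::]
| T_App G D w v V W m b :
    ty_inter G w V [:: (1, Arr m b)] ->
    ty_inter D v W m ->
    ty_dist (ctx_add G D) (w + v) (App V W) b
| T_Oplus G D w v M N a b :
    ty_dist G w M a ->
    ty_dist D v N b ->
    ty_dist (ctx_add (ctx_scale 2^-1 G) (ctx_scale 2^-1 D))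
            (2^-1 * w + 2^-1 * v + 1) (Oplus M N)
            (scale 2^-1 a ++ scale 2^-1 b)
| T_Let n G v N M (p : 'I_n -> rat) (m : 'I_n -> inter)
    (D : 'I_n -> ctx) (w : 'I_n -> rat) (b : 'I_n -> tydist) :
    ty_dist G v N [seq (p k, m k) | k <- enum 'I_n] ->
    (forall k, ty_dist (ctx_cons (m k) (D k)) (w k) M (b k)) ->
    ty_dist (ctx_add G (ctx_sum (fun k => ctx_scale (p k) (D k))))
            (\sum_(k < n) p k * w k + v + 1) (Let N M)
            (\big[cat/[::]]_(k < n) scale (p k) (b k))
| T_Val G w V m :
    ty_inter G w V m ->
    ty_dist G w (Ret V) [:: (1, m)]
| T_dist_eq G D w M a b :
    ty_dist G w M a -> ctx_eq G D -> eq_tydist a b -> ty_dist D w M b.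

(* Supremum of the weights w such that |-^w M : 0 is derivable, 0 being the
   empty type distribution. *)
Definition weight_sup (R : realType) (M : term) : \bar R :=
  ereal_sup [set (ratr w : R)%:E | w in [set w : rat | ty_dist ctx0 w M [::]]]%classic.

(* Main.v *)
(** Soundness is a realizability argument.  A value realizes an
    arrow type with weight [w] when, placed under any stack of pending lets that
    accepts the result type, its application runs for at least the number of
    steps announced by [w], by the weight of the argument and by the stack.  By
    induction on derivations every typed term is realized by its substitution
    instances, and the empty stack gives that [|-^w M : 0] implies
    [w <= Ek k M] for some [k].

    Completeness is weighted subject expansion along [k] steps.  It is carried
    out on configurations (term, environment of closures, stack of pending
    lets): since a configuration keeps its substitutions delayed, typing an
    environment replaces the anti-substitution lemma for derivations. *)

Require Import Defs.
From mathcomp Require Import all_boot all_order all_algebra.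
From mathcomp Require Import boolp classical_sets reals constructive_ereal ereal.
From mathcomp Require Import ring lra.

Set Implicit Arguments.
Unset Strict Implicit.
Unset Printing Implicit Defensive.

Import Order.TTheory GRing.Theory Num.Theory.
Local Open Scope ring_scope.

Scheme value_mut := Induction for value Sort Prop
with term_mut := Induction for term Sort Prop.
Combined Scheme value_term_ind from value_mut, term_mut.

Scheme ty_arrow_mut := Minimality for ty_arrow Sort Prop
with ty_inter_mut := Minimality for ty_inter Sort Prop
with ty_dist_mut := Minimality for ty_dist Sort Prop.
Combined Scheme ty_mutind from ty_arrow_mut, ty_inter_mut, ty_dist_mut.

(** * Substitution *)

Definition scons (V : value) (s : nat -> value) (n : nat) : value :=
  if n is m.+1 then s m else V.

(** The fusion laws come in dependency order: crossing a binder in [ren_subst] uses [ren_ren], and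
    in [subst_subst] it uses [subst_ren] and [ren_subst]. *)
Lemma subst_ren :
  (forall V r s, subst_value s (ren_value r V) = subst_value (s \o r) V) /\
  (forall M r s, subst_term s (ren_term r M) = subst_term (s \o r) M).
Proof.
have upE r s : up_subst s \o up_ren r = up_subst (s \o r).
  by apply: funext => -[].
apply: value_term_ind => //=.
- by move=> M IH r s; rewrite IH upE.
- by move=> V IH r s; rewrite IH.
- by move=> V IHV W IHW r s; rewrite IHV IHW.
- by move=> M IHM N IHN r s; rewrite IHM IHN.
- by move=> M IHM N IHN r s; rewrite IHM IHN upE.
Qed.

Lemma ren_ren :
  (forall V r1 r2, ren_value r2 (ren_value r1 V) = ren_value (r2 \o r1) V) /\
  (forall M r1 r2, ren_term r2 (ren_term r1 M) = ren_term (r2 \o r1) M).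
Proof.
have upE r1 r2 : up_ren r2 \o up_ren r1 = up_ren (r2 \o r1).
  by apply: funext => -[].
apply: value_term_ind => //=.
- by move=> M IH r s; rewrite IH upE.
- by move=> V IH r s; rewrite IH.
- by move=> V IHV W IHW r s; rewrite IHV IHW.
- by move=> M IHM N IHN r s; rewrite IHM IHN.
- by move=> M IHM N IHN r s; rewrite IHM IHN upE.
Qed.

Lemma ren_subst :
  (forall V s r, ren_value r (subst_value s V) = subst_value (ren_value r \o s) V) /\
  (forall M s r, ren_term r (subst_term s M) = subst_term (ren_value r \o s) M).
Proof.
have upE s r : ren_value (up_ren r) \o up_subst s = up_subst (ren_value r \o s).
  by apply: funext => -[|n] //=; rewrite !ren_ren.1.
apply: value_term_ind => //=.
- by move=> M IH r s; rewrite IH upE.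
- by move=> V IH r s; rewrite IH.
- by move=> V IHV W IHW r s; rewrite IHV IHW.
- by move=> M IHM N IHN r s; rewrite IHM IHN.
- by move=> M IHM N IHN r s; rewrite IHM IHN upE.
Qed.

Lemma subst_subst :
  (forall V s t, subst_value t (subst_value s V) = subst_value (subst_value t \o s) V) /\
  (forall M s t, subst_term t (subst_term s M) = subst_term (subst_value t \o s) M).
Proof.
have upE s t : subst_value (up_subst t) \o up_subst s = up_subst (subst_value t \o s).
  by apply: funext => -[|n] //=; rewrite subst_ren.1 ren_subst.1.
apply: value_term_ind => //=.
- by move=> M IH r s; rewrite IH upE.
- by move=> V IH r s; rewrite IH.
- by move=> V IHV W IHW r s; rewrite IHV IHW.
- by move=> M IHM N IHN r s; rewrite IHM IHN.
- by move=> M IHM N IHN r s; rewrite IHM IHN upE.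
Qed.

Lemma subst_id :
  (forall V, subst_value Var V = V) /\ (forall M, subst_term Var M = M).
Proof.
have upE : up_subst Var = Var by apply: funext => -[].
apply: value_term_ind => //=; rewrite ?upE.
- by move=> M ->.
- by move=> V ->.
- by move=> V -> W ->.
- by move=> M -> N ->.
- by move=> M -> N ->.
Qed.

Lemma subst_bounded :
  (forall V n s, bounded_value n V -> (forall x, (x < n)%N -> s x = Var x) ->
     subst_value s V = V) /\
  (forall M n s, bounded_term n M -> (forall x, (x < n)%N -> s x = Var x) ->
     subst_term s M = M).
Proof.
have up n s : (forall x, (x < n)%N -> s x = Var x) ->
    forall x, (x < n.+1)%N -> up_subst s x = Var x.
  by move=> h [|x] //= /h ->.
apply: value_term_ind => /=.
- by move=> x n s bx; apply.
- by move=> M IH n s bM h; rewrite (IH _ _ bM (up _ _ h)).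
- by move=> V IH n s bV h; rewrite (IH _ _ bV h).
- by move=> V IHV W IHW n s /andP[bV bW] h; rewrite (IHV _ _ bV h) (IHW _ _ bW h).
- by move=> M IHM N IHN n s /andP[bM bN] h; rewrite (IHM _ _ bM h) (IHN _ _ bN h).
- by move=> N IHN M IHM n s /andP[bN bM] h; rewrite (IHN _ _ bN h) (IHM _ _ bM (up _ _ h)).
Qed.

Lemma subst_closed (s : nat -> value) (M : term) : closed_term M -> subst_term s M = M.
Proof. by move=> cM; apply: (subst_bounded.2 _ 0%N). Qed.

(** Turns the firing of a redex into an extension of the surrounding substitution; beta and let
    steps are handled in this form in both directions. *)
Lemma subst0_up (W : value) (s : nat -> value) (M : term) :
  subst0 W (subst_term (up_subst s) M) = subst_term (scons W s) M.
Proof.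
rewrite /subst0 subst_subst.2; congr subst_term.
by apply: funext => -[|n] //=; rewrite subst_ren.1 /comp /= subst_id.1.
Qed.

(** * Expected number of steps *)

(** The let rule leaves coefficients untouched, so sums over a reduct have at most two summands. *)
Lemma reduct_cases (M : term) :
  [\/ reduct M = None,
      exists M', reduct M = Some [:: (1, M')]
    | exists M1 M2, reduct M = Some [:: (2^-1, M1); (2^-1, M2)]].
Proof.
elim: M => [V|[x|M] W|M _ N _|N IH M _] /=.
- exact: Or31.
- exact: Or31.
- by apply: Or32; eexists.
- by apply: Or33; do 2 eexists.
- case: N IH => [V|V W|N1 N2|N1 N2] IH; first by apply: Or32; eexists.
  all: case: IH => [->|[M' ->]|[M1 [M2 ->]]];
    [exact: Or31|by apply: Or32; eexists|by apply: Or33; do 2 eexists].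
Qed.

Lemma lift_term_ge0 (M : term) : all (fun x => 0 <= x.1) (lift_term M).
Proof. by rewrite /lift_term; case: (reduct_cases M) => [->|[M' ->]|[M1 [M2 ->]]]. Qed.

Lemma lift_term_sum (M : term) : \sum_(x <- lift_term M) x.1 = 1.
Proof.
rewrite /lift_term; case: (reduct_cases M) => [->|[M' ->]|[M1 [M2 ->]]];
  by rewrite ?big_cons big_nil ?addr0 //=; lra.
Qed.

Definition valprob (m : wseq term) : rat := \sum_(x <- m | is_value x.2) x.1.

(** [lift_mdist] commutes with concatenation and with scaling, hence so do its iterates. *)
Lemma valprob_lift_iter (k : nat) (m : wseq term) :
  valprob (iter k lift_mdist m) = \sum_(x <- m) x.1 * Pk k x.2.
Proof.
have sc u (s : wseq term) : valprob (scale u s) = u * valprob s.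
  by rewrite /valprob /scale big_map mulr_sumr.
have lcat s t : lift_mdist (s ++ t) = lift_mdist s ++ lift_mdist t.
  by rewrite /lift_mdist map_cat flatten_cat.
have lsc u s : lift_mdist (scale u s) = scale u (lift_mdist s).
  elim: s => //= -[p M] s IH; rewrite /lift_mdist /= in IH *.
  rewrite {}IH /scale map_cat; congr (_ ++ _).
  by rewrite -map_comp; apply: eq_map => x /=; rewrite mulrA.
have i0 : iter k lift_mdist [::] = [::] by elim: k => //= k ->.
have icat s t : iter k lift_mdist (s ++ t)
    = iter k lift_mdist s ++ iter k lift_mdist t.
  by elim: k {i0} => //= k ->.
have isc u s : iter k lift_mdist (scale u s) = scale u (iter k lift_mdist s).
  by elim: k {i0 icat} => //= k ->.
elim: m => [|[p M] m IH].
  by rewrite i0 /valprob !big_nil.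
rewrite big_cons -cat1s icat /valprob big_cat /= -[X in _ + X]/(valprob _) IH.
congr (_ + _); rewrite -[LHS]/(valprob _).
by rewrite (_ : [:: (p, M)] = scale p [:: (1, M)]) ?isc ?sc // /scale /= mulr1.
Qed.

Lemma Pk0 (M : term) : Pk 0 M = (is_value M)%:R.
Proof. by rewrite /Pk /= big_cons big_nil /=; case: is_value; rewrite ?addr0. Qed.

Lemma PkS (k : nat) (M : term) :
  Pk k.+1 M = \sum_(x <- lift_term M) x.1 * Pk k x.2.
Proof.
rewrite -valprob_lift_iter /Pk /mdist_at iterSr /lift_mdist /= cats0.
rewrite /scale (eq_map (g := id)) ?map_id // => -[p N] /=.
by rewrite mul1r.
Qed.

(** First-step analysis. The summand for [j = 0] is the indicator; in the others, since
    [lift_term M] has mass 1, the complement distributes over the average given by [PkS]. *)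
Lemma EkS (k : nat) (M : term) :
  Ek k.+1 M = (~~ is_value M)%:R + \sum_(x <- lift_term M) x.1 * Ek k x.2.
Proof.
rewrite /Ek big_ord_recl Pk0 /=; congr (_ + _); first by case: is_value; rewrite ?subrr ?subr0.
under [RHS]eq_bigr do rewrite mulr_sumr.
rewrite exchange_big /=; apply: eq_bigr => i _.
rewrite PkS -{1}(lift_term_sum M) -sumrB.
by apply: eq_bigr => x _; rewrite mulrBr mulr1.
Qed.

Lemma Ek0 (M : term) : Ek 0 M = 0.
Proof. by rewrite /Ek big_ord0. Qed.

Lemma Ek_Ret (k : nat) (V : value) : Ek k (Ret V) = 0.
Proof.
elim: k => [|k IH]; first exact: Ek0.
by rewrite EkS /= /lift_term /= big_cons big_nil IH; lra.
Qed.

Lemma Ek_leS (k : nat) (M : term) : Ek k M <= Ek k.+1 M.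
Proof.
elim: k M => [|k IH] M; rewrite [X in _ <= X]EkS.
  rewrite Ek0 addr_ge0 ?ler0n //.
  by rewrite big1 // => x _; rewrite Ek0 mulr0.
rewrite EkS lerD2l; have := lift_term_ge0 M.
elim: (lift_term M) => [|x s IHs] /=; rewrite ?big_nil // !big_cons.
by case/andP => x0 s0; rewrite lerD ?ler_wpM2l ?IHs.
Qed.

Lemma Ek_le (j k : nat) (M : term) : (j <= k)%N -> Ek j M <= Ek k M.
Proof.
move=> /subnKC <-; elim: (k - j)%N => [|i IH]; first by rewrite addn0.
by rewrite addnS (le_trans IH) ?Ek_leS.
Qed.

Lemma Ek_reduct (k : nat) (M : term) (m : wseq term) :
  reduct M = Some m -> Ek k.+1 M = 1 + \sum_(x <- m) x.1 * Ek k x.2.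
Proof. by move=> h; rewrite EkS /lift_term h; case: M h. Qed.

(** The head of [K] is the innermost let: [plug (P :: K) N] is convertible to [plug K (Let N P)], so
    moving the focus into a let changes nothing. *)
Definition plug (K : seq term) (T : term) : term := foldl Let T K.

Lemma is_value_plug (K : seq term) (T : term) :
  ~~ is_value T -> ~~ is_value (plug K T).
Proof. by elim: K T => //= P K IH T _; apply: IH. Qed.

(** Values are excluded because on a value the innermost let fires instead of passing a reduction
    on. *)
Lemma reduct_plug (K : seq term) (T : term) : ~~ is_value T ->
  reduct (plug K T) = omap (map_wseq (plug K)) (reduct T).
Proof.
elim: K T => [|P K IH] T nT /=.
  case: (reduct T) => //= m; congr Some.
  by elim: m => //= -[p N] m <-.
rewrite IH // (_ : reduct (Let T P) = omap (map_wseq (fun N => Let N P)) (reduct T)).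
  by case: (reduct T) => //= m; congr Some; rewrite /map_wseq -map_comp.
by case: T nT.
Qed.

Lemma reduct_plugS (K : seq term) (T : term) (m : wseq term) :
  reduct T = Some m -> reduct (plug K T) = Some (map_wseq (plug K) m).
Proof. by move=> h; rewrite reduct_plug ?h //; case: T h. Qed.

Lemma Ek_plug1 (k : nat) (K : seq term) (T T' : term) :
  reduct T = Some [:: (1, T')] -> Ek k.+1 (plug K T) = 1 + Ek k (plug K T').
Proof.
by move=> /(reduct_plugS K) /Ek_reduct ->; rewrite big_cons big_nil /=; lra.
Qed.

Lemma Ek_plug2 (k : nat) (K : seq term) (M N : term) :
  Ek k.+1 (plug K (Oplus M N))
  = 1 + 2^-1 * Ek k (plug K M) + 2^-1 * Ek k (plug K N).
Proof.
by rewrite (Ek_reduct _ (reduct_plugS K (erefl : reduct (Oplus M N) = _)))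
  !big_cons big_nil /=; lra.
Qed.

(* Each pending let costs at least one step, whatever is being evaluated. *)
Lemma Ek_plug_ge (K : seq term) (T : term) :
  (size K)%:R <= Ek (size K) (plug K T) :> rat.
Proof.
(* Generalised to every [k] up to the size: a term that is not a value uses up a step while the
   stack stays the same. *)
suff H k : (k <= size K)%N -> k%:R <= Ek k (plug K T) by exact: H.
elim: k K T => [|k IH] K T; first by rewrite Ek0.
case: K => //= P K lek; rewrite ltnS in lek.
have -> : k.+1%:R = 1 + k%:R :> rat by rewrite -addn1 natrD addrC.
have [[V ->]|nV] : (exists V, T = Ret V) \/ ~~ is_value T.
- by case: T; [left; eexists|right|right|right].
- by rewrite (Ek_plug1 _ _ (erefl : reduct (Let (Ret V) P) = _)) lerD2l IH.
have IHL N : k%:R <= Ek k (plug (P :: K) N) by apply: IH; rewrite ltnW.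
rewrite EkS /= (is_value_plug K (T := Let T P)) // lerD2l.
rewrite /lift_term (reduct_plug (P :: K) nV).
case: (reduct_cases T) => [->|[T' ->]|[T1 [T2 ->]]]; rewrite !big_cons big_nil /=.
- by rewrite mul1r addr0; exact: IHL.
- by rewrite mul1r addr0; exact: IHL.
- by have /= := IHL T1; have /= := IHL T2; lra.
Qed.

(** * Realizability *)

Section WeightedSum.
Variables (T : Type) (R : T -> rat -> Prop).

(** A relation and not a function: [R] may hold of an element with several weights, and one is
    chosen for each occurrence. [R] stays fixed in the recursion, so that [realizes] and [cty] can
    recurse through it. *)
Fixpoint wsum (s : wseq T) (w : rat) : Prop :=
  match s with
  | [::] => w = 0
  | (q, A) :: s' =>
    exists w1 w2, [/\ R A w1, wsum s' w2 & w = q * w1 + w2]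
  end.

Lemma wsum_cat (s t : wseq T) (w : rat) :
  wsum (s ++ t) w <-> exists w1 w2, [/\ wsum s w1, wsum t w2 & w = w1 + w2].
Proof.
elim: s w => [|[q A] s IH] w /=; split.
- by move=> h; exists 0, w; rewrite add0r.
- by move=> [_ [w2 [-> h ->]]]; rewrite add0r.
- move=> [w1 [_ [hA /IH[w2 [w3 [h2 h3 ->]]] ->]]].
  by exists (q * w1 + w2), w3; rewrite addrA; split => //; exists w1, w2.
- move=> [_ [w3 [[w1 [w2 [hA h2 ->]]] h3 ->]]].
  exists w1, (w2 + w3); rewrite addrA; split => //.
  by apply/IH; exists w2, w3.
Qed.

Lemma wsum_scale (u : rat) (s : wseq T) (w : rat) :
  wsum (scale u s) w <-> exists2 w', wsum s w' & w = u * w'.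
Proof.
elim: s w => [|[q A] s IH] w /=; split.
- by move=> ->; exists 0; rewrite ?mulr0.
- by move=> [_ ->]; rewrite mulr0.
- move=> [w1 [_ [hA /IH[w2 h2 ->] ->]]].
  by exists (q * w1 + w2); [exists w1, w2|ring].
- move=> [_ [w1 [w2 [hA h2 ->]]] ->].
  exists w1, (u * w2); split => //; last ring.
  by apply/IH; exists w2.
Qed.

Lemma wsum_bigcat (n : nat) (s : 'I_n -> wseq T) (w : rat) :
  wsum (\big[cat/[::]]_(k < n) s k) w ->
  exists2 ws : 'I_n -> rat, forall k, wsum (s k) (ws k) & w = \sum_k ws k.
Proof.
elim: n s w => [|n IH] s w.
  by rewrite !big_ord0 => /= ->; exists (fun=> 0); [case|rewrite big_ord0].
rewrite big_ord_recl => /wsum_cat[w1 [w2 [h1 /IH[ws hws ->] ->]]].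
exists (fun k => if unlift ord0 k is Some j then ws j else w1) => [k|].
  by case: unliftP => [j ->|->].
by rewrite big_ord_recl unlift_none; congr (_ + _); apply: eq_bigr => k _; rewrite liftK.
Qed.

Lemma wsum_enum (n : nat) (q : 'I_n -> rat) (A : 'I_n -> T) (w : 'I_n -> rat) :
  (forall i, R (A i) (w i)) ->
  wsum [seq (q i, A i) | i <- enum 'I_n] (\sum_i q i * w i).
Proof.
elim: n q A w => [|n IH] q A w h.
  by rewrite big_ord0 (size0nil (size_enum_ord 0)).
rewrite enum_ordSl big_ord_recl /= -map_comp.
exists (w ord0), (\sum_i q (lift ord0 i) * w (lift ord0 i)); split => //.
by apply: (IH (q \o lift ord0) (A \o lift ord0) (w \o lift ord0)) => i; apply: h.
Qed.

End WeightedSum.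

Lemma wsum_eq (T : Type) (E : T -> T -> Prop) (R : T -> rat -> Prop) (s t : wseq T) :
  (forall A B, E A B -> forall w, R A w <-> R B w) ->
  eq_wseq E s t -> forall w, wsum R s w <-> wsum R t w.
Proof.
move=> RE; elim=> {s t}; [by []|..|by move=> s t u _ st _ tu w; rewrite st].
- move=> q A B s t /RE AB _ IH w /=.
  by split=> -[w1 [w2 [/AB h1 /IH h2 ->]]]; exists w1, w2.
- move=> [p A] [q B] s w /=; split=> -[w1 [_ [h1 [w2 [w3 [h2 h3 ->]]] ->]]].
  + by exists w2, (p * w1 + w3); split; [|exists w1, w3|ring].
  + by exists w2, (q * w1 + w3); split; [|exists w1, w3|ring].

Qed.

Lemma eq_wseq_nil_inv (T : Type) (E : T -> T -> Prop) (s t : wseq T) :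
  eq_wseq E s t -> s = [::] <-> t = [::].
Proof. by elim=> {s t} // s t u _ st _; rewrite st. Qed.

(** * Weighted typing of environments *)

Section Environment.
Variables (V : Type) (R : V -> arrow -> rat -> Prop).

(** Serves soundness with values and [realizes], completeness with closures and [cty]. The base case
    forces the context to be empty beyond the environment. *)
Fixpoint wenv (s : seq V) (G : ctx) (w : rat) : Prop :=
  match s with
  | [::] => (forall x, G x = [::]) /\ w = 0
  | v :: s' => exists w1 w2,
    [/\ wsum (R v) (G 0%N) w1, wenv s' (fun x => G x.+1) w2 & w = w1 + w2]
  end.

Lemma wenv0 (s : seq V) : wenv s ctx0 0.
Proof. by elim: s => [|v s IH] //=; exists 0, 0; rewrite addr0. Qed.

Lemma wenv_add (s : seq V) (G D : ctx) (w : rat) :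
  wenv s (ctx_add G D) w <->
  exists w1 w2, [/\ wenv s G w1, wenv s D w2 & w = w1 + w2].
Proof.
elim: s G D w => [|v s IH] G D w /=; split.
- move=> [h ->]; exists 0, 0; rewrite addr0; split=> //; split=> // x;
    by have := h x; rewrite /ctx_add; case: (G x).
- by move=> [_ [_ [[hG ->] [hD ->] ->]]]; rewrite addr0; split=> // x; rewrite /ctx_add hG hD.
- move=> [_ [_ [/wsum_cat[a [b [ha hb ->]]] /IH[c [d [hc hd ->]]] ->]]].
  exists (a + c), (b + d); split; [by exists a, c|by exists b, d|ring].
- move=> [_ [_ [[a [c [ha hc ->]]] [b [d [hb hd ->]]] ->]]].
  exists (a + b), (c + d); split; last ring.
  + by apply/wsum_cat; exists a, b.
  + by apply/IH; exists c, d.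
Qed.

Lemma wenv_scale (s : seq V) (u : rat) (G : ctx) (w : rat) :
  wenv s (ctx_scale u G) w <-> exists2 w', wenv s G w' & w = u * w'.
Proof.
elim: s G w => [|v s IH] G w /=; split.
- move=> [h ->]; exists 0; rewrite ?mulr0 //; split=> // x.
  by have := h x; rewrite /ctx_scale; case: (G x).
- by move=> [_ [h ->] ->]; rewrite mulr0; split=> // x; rewrite /ctx_scale h.
- move=> [_ [_ [/wsum_scale[a ha ->] /IH[b hb ->] ->]]].
  by exists (a + b); [exists a, b|ring].
- move=> [_ [a [b [ha hb ->]]] ->].
  exists (u * a), (u * b); split; last ring.
  + by apply/wsum_scale; exists a.
  + by apply/IH; exists b.
Qed.

Lemma wenv_sum (s : seq V) (n : nat) (D : 'I_n -> ctx) (w : rat) :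
  wenv s (ctx_sum D) w ->
  exists2 ws : 'I_n -> rat, forall k, wenv s (D k) (ws k) & w = \sum_k ws k.
Proof.
elim: n D w => [|n IH] D w.
  have -> : ctx_sum D = ctx0 by apply: funext => y; rewrite /ctx_sum big_ord0.
  move=> h; exists (fun=> 0) => [[]//|]; rewrite big_ord0.
  elim: s w h => [|v s IHs] w /=; first by case.
  by move=> [_ [w2 [-> /IHs -> ->]]]; rewrite addr0.
have -> : ctx_sum D = ctx_add (D ord0) (ctx_sum (fun k => D (lift ord0 k))).
  by apply: funext => y; rewrite /ctx_sum big_ord_recl.
move=> /wenv_add[w1 [w2 [h1 /IH[ws hws ->] ->]]].
exists (fun k => if unlift ord0 k is Some j then ws j else w1) => [k|].
  by case: unliftP => [j ->|->].
by rewrite big_ord_recl unlift_none; congr (_ + _); apply: eq_bigr => k _; rewrite liftK.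
Qed.

Lemma wenv_eq (s : seq V) (G D : ctx) :
  (forall v A B, eq_arrow A B -> forall w, R v A w <-> R v B w) ->
  ctx_eq G D -> forall w, wenv s G w <-> wenv s D w.
Proof.
move=> RE; elim: s G D => [|v s IH] G D GD w /=.
  by split=> -[h ->]; split=> // x; apply/(eq_wseq_nil_inv (GD x)).
have h1 := wsum_eq (RE v) (GD 0%N).
have h2 := IH _ _ (fun x => GD x.+1).
by split=> -[w1 [w2 [/h1 ? /h2 ? ->]]]; exists w1, w2.
Qed.

(** Past the end of the environment, [ctx1 x m] is accepted only for [m] empty, so the default [d]
    does no harm. *)
Lemma wenv_var (d : V) (s : seq V) (x : nat) (m : inter) (w : rat) :
  wenv s (ctx1 x m) w -> wsum (R (nth d s x)) m w.
Proof.
elim: s x w => [|v s IH] [|x] w /=.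
- by move=> [/(_ 0%N)]; rewrite /ctx1 eqxx => -> ->.
- by move=> [/(_ x.+1)]; rewrite /ctx1 eqxx => -> ->.
- move=> [w1 [w2 [h1 h2 ->]]].
  suff -> : w2 = 0 by rewrite addr0.
  elim: s w2 h2 {IH} => [|? s IH] w2 /=; first by case.
  by move=> [_ [w3 [-> /IH -> ->]]]; rewrite addr0.
- by move=> [_ [w2 [-> /IH h ->]]]; rewrite add0r.
Qed.

Lemma wenv_var_inv (d : V) (s : seq V) (x : nat) (m : inter) (w : rat) :
  (x < size s)%N -> wsum (R (nth d s x)) m w -> wenv s (ctx1 x m) w.
Proof.
elim: s x => [|v s IH] [|x] //= lt h; last first.
  by exists 0, w; rewrite add0r; split=> //; apply: IH.
by exists w, 0; rewrite addr0; split=> //; apply: wenv0.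
Qed.

End Environment.

(** Realizability by testing against stacks. The predicate on [n] is [accepts K] written out, since
    [accepts] is itself defined from [realizes]. The beta step is not counted apart: the unit added
    by [T_Lam] pays for it. *)
Fixpoint realizes (A : arrow) (V : value) (w : rat) {struct A} : Prop :=
  let: Arr m a := A in
  forall W v, wsum (fun B => realizes B W) m v ->
  forall K e,
    wsum (fun (n : seq (rat * arrow)) c => forall U u,
            wsum (fun B => realizes B U) n u ->
            exists j, u + c + (size K)%:R <= Ek j (plug K (Ret U))) a e ->
  exists j, w + v + (size K)%:R + e <= Ek j (plug K (App V W)).

(* [c] is a lower bound on the steps that the stack [K] performs once it
   receives a value of type [m], not counting one step per let in [K] and the
   weight of the value itself.  Counting the lets apart makes the bound valid
   when the evaluation that precedes loses probability mass. *)
Definition accepts (K : seq term) (m : inter) (c : rat) : Prop :=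
  forall U u, wsum (realizes^~ U) m u ->
  exists j, u + c + (size K)%:R <= Ek j (plug K (Ret U)).

Definition realizes_dist (a : tydist) (M : term) (w : rat) : Prop :=
  forall K e, wsum (accepts K) a e ->
  exists j, w + (size K)%:R + e <= Ek j (plug K M).

(** * Invariance of realizability under equality of types *)

Section EqWseqMono.
Variables (T : Type) (E E' : T -> T -> Prop) (EE' : forall A B, E A B -> E' A B).

(** [EE'] stays outside the recursion, so that [eq_arrow_realizers] can pass itself for [EE'] and
    remain structurally recursive. *)
Fixpoint eq_wseq_mono (s t : wseq T) (h : eq_wseq E s t) : eq_wseq E' s t :=
  match h with
  | eq_wseq_nil => eq_wseq_nil E'
  | eq_wseq_cons q A B s t hAB hst => eq_wseq_cons q (EE' hAB) (eq_wseq_mono hst)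
  | eq_wseq_swap x y s => eq_wseq_swap E' x y s
  | eq_wseq_trans s t u hst htu => eq_wseq_trans (eq_wseq_mono hst) (eq_wseq_mono htu)
  end.

End EqWseqMono.

Definition same_realizers (A B : arrow) : Prop :=
  forall V w, realizes A V w <-> realizes B V w.

Lemma wsum_realizes_eq (V : value) (m n : inter) :
  eq_wseq same_realizers m n ->
  forall w, wsum (realizes^~ V) m w <-> wsum (realizes^~ V) n w.
Proof. by apply: wsum_eq => A B AB w; apply: AB. Qed.

Lemma accepts_eq (K : seq term) (a b : tydist) :
  eq_wseq (eq_wseq same_realizers) a b ->
  forall e, wsum (accepts K) a e <-> wsum (accepts K) b e.
Proof.
apply: wsum_eq => m n /wsum_realizes_eq mn c.
by split=> h U u /mn; apply: h.
Qed.

Lemma same_realizers_Arr (m n : inter) (a b : tydist) :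
  eq_wseq same_realizers m n -> eq_wseq (eq_wseq same_realizers) a b ->
  same_realizers (Arr m a) (Arr n b).
Proof.
move=> /wsum_realizes_eq mn /accepts_eq ab V w.
by split=> h W v /mn hv K e /ab he; apply: h.
Qed.

Fixpoint eq_arrow_realizers (A B : arrow) (h : eq_arrow A B) : same_realizers A B :=
  match h with
  | eq_Arr m n a b hm ha =>
    same_realizers_Arr (eq_wseq_mono eq_arrow_realizers hm)
      (eq_wseq_mono (fun m n => @eq_wseq_mono _ _ _ eq_arrow_realizers m n) ha)
  end.

Lemma eq_tydist_realizers (a b : tydist) :
  eq_tydist a b -> eq_wseq (eq_wseq same_realizers) a b.
Proof. by apply: eq_wseq_mono => m n; apply: eq_wseq_mono eq_arrow_realizers _ _. Qed.

Definition env (s : seq value) : nat -> value := nth (Lam (Ret (Var 0))) s.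

(** Sums and scalings of contexts become sums and multiples of the environment weight [u], so each
    rule reduces to arithmetic on weights. *)
Lemma ty_sound :
  (forall G w V A, ty_arrow G w V A -> forall s u, wenv (fun V A => realizes A V) s G u ->
     realizes A (subst_value (env s) V) (w + u)) /\
  (forall G w V m, ty_inter G w V m -> forall s u, wenv (fun V A => realizes A V) s G u ->
     wsum (realizes^~ (subst_value (env s) V)) m (w + u)) /\
  (forall G w M a, ty_dist G w M a -> forall s u, wenv (fun V A => realizes A V) s G u ->
     realizes_dist a (subst_term (env s) M) (w + u)).
Proof.
have sconsE V s : scons V (env s) = env (V :: s) by apply: funext => -[].
have REq v A B : eq_arrow A B -> forall w, realizes A v w <-> realizes B v w.
  by move=> /eq_arrow_realizers h w; apply: h.
apply: ty_mutind.
- move=> G w M m b _ IH s u hu W v hv K e he.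
  (* The argument joins the environment, and its weight that of the environment. *)
  have [|j hj] := IH (W :: s) (v + u) _ K e he; first by exists v, u.
  exists j.+1; rewrite [plug K _]/= (@Ek_plug1 _ _ _ (subst_term (env (W :: s)) M)).
    by lra.
  by rewrite /= subst0_up sconsE.
- move=> G D w V A B _ IH GD AB s u hu.
  by apply/(REq _ _ _ AB)/IH/(wenv_eq s REq GD).
- by move=> x m _ s u hu; rewrite add0r; apply: wenv_var hu.
- move=> n G w q V A _ _ IH s u /wenv_sum[us hus ->].
  have /choice[vs hvs] k : exists v, wenv (fun V A => realizes A V) s (G k) v /\ us k = q k * v.
    by have /wenv_scale[v hv ->] := hus k; exists v.
  have -> : \sum_k us k = \sum_k q k * vs k by apply: eq_bigr => k _; exact: (hvs k).2.
  rewrite -big_split /= (eq_bigr (fun k => q k * (w k + vs k))); last first.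
    by move=> k _; rewrite mulrDr.
  apply: (wsum_enum (R := realizes^~ (subst_value (env s) V))) => k.
  by apply: IH; exact: (hvs k).1.
- move=> G D w V m n _ IH GD mn s u hu.
  by apply/(wsum_eq (REq _) mn)/IH/(wenv_eq s REq GD).
- move=> M s u hu K e /= ->.
  have -> : u = 0.
    elim: s u hu => [|v s IHs] w /=; first by case.
    by move=> [_ [w2 [-> /IHs -> ->]]]; rewrite addr0.
  (* The type [0] announces nothing beyond one step for each pending let. *)
  by exists (size K); rewrite !addr0 add0r Ek_plug_ge.
- move=> G D w v V W m b _ IHV _ IHW s u /wenv_add[u1 [u2 [h1 h2 ->]]] K e he.
  have [w1 [_ [hV -> wE]]] := IHV _ _ h1.
  have [j hj] := hV _ _ (IHW _ _ h2) K e he.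
  by exists j => /=; lra.
- move=> G D w v M N a b _ IHM _ IHN s u.
  move=> /wenv_add[_ [_ [/wenv_scale[u1 h1 ->] /wenv_scale[u2 h2 ->] ->]]] K e.
  move=> /wsum_cat[_ [_ [/wsum_scale[e1 he1 ->] /wsum_scale[e2 he2 ->] ->]]].
  have [j1 hj1] := IHM _ _ h1 K e1 he1.
  have [j2 hj2] := IHN _ _ h2 K e2 he2.
  (* The branches may need different numbers of steps; monotonicity of [Ek] brings both to the
     maximum. *)
  exists (maxn j1 j2).+1; rewrite [subst_term _ _]/= Ek_plug2.
  have := Ek_le (plug K (subst_term (env s) M)) (leq_maxl j1 j2).
  have := Ek_le (plug K (subst_term (env s) N)) (leq_maxr j1 j2).
  by lra.
- move=> n G v N M p m D w b _ IHN _ IHM s u.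
  move=> /wenv_add[u1 [_ [h1 /wenv_sum[us hus ->] ->]]] K e.
  have /choice[vs hvs] k : exists v, wenv (fun V A => realizes A V) s (D k) v /\ us k = p k * v.
    by have /wenv_scale[x hx ->] := hus k; exists x.
  move=> /wsum_bigcat[es hes ->].
  have /choice[cs hcs] k : exists c, wsum (accepts K) (b k) c /\ es k = p k * c.
    by have /wsum_scale[x hx ->] := hes k; exists x.
  set P := subst_term (up_subst (env s)) M.
  (* On a value of type [m k], firing the let of [P] is the step counted for its frame; the
     induction hypothesis on the body bounds the rest. *)
  have hK : wsum (accepts (P :: K)) [seq (p k, m k) | k <- enum 'I_n]
      (\sum_k p k * (w k + vs k + cs k)).
    apply: wsum_enum => k U x hx.
    have [|j hj] := IHM k (U :: s) (x + vs k) _ K (cs k) (hcs k).1.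
      by exists x, (vs k); split=> //; exact: (hvs k).1.
    exists j.+1; rewrite [plug _ _]/= (@Ek_plug1 _ _ _ (subst_term (env (U :: s)) M)).
      by rewrite /= -addn1 natrD; lra.
    by rewrite /= subst0_up sconsE.
  (* The longer stack counts one more let, which is the unit added by [T_Let]. *)
  have [j hj] := IHN _ _ h1 (P :: K) _ hK.
  exists j; apply: le_trans hj; rewrite /= -addn1 natrD le_eqVlt; apply/orP; left.
  apply/eqP.
  have -> : \sum_k us k = \sum_k p k * vs k by apply: eq_bigr => k _; exact: (hvs k).2.
  have -> : \sum_k es k = \sum_k p k * cs k by apply: eq_bigr => k _; case: (hcs k).
  have -> : \sum_k p k * (w k + vs k + cs k)
    = \sum_k p k * w k + \sum_k p k * vs k + \sum_k p k * cs k.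
    by rewrite -!big_split; apply: eq_bigr => k _ /=; rewrite !mulrDr.
  by lra.
- move=> G w V m _ IH s u hu K e /= [c [_ [hc -> ->]]].
  by have [j hj] := hc _ _ (IH _ _ hu); exists j; lra.
- move=> G D w M a b _ IH GD ab s u hu K e he.
  apply: IH; first exact/(wenv_eq s REq GD).
  by apply/(accepts_eq K (eq_tydist_realizers ab)).
Qed.

(** * Environment machine *)

(** [Clo M s] is an abstraction with body [M]: index 0 is the parameter, index [i.+1] refers to
    entry [i] of [s]. *)
Inductive clo : Type := Clo (M : term) (s : seq clo).

Fixpoint uclo (c : clo) : value :=
  let: Clo M s := c in Lam (subst_term (up_subst (env (map uclo s))) M).

Fixpoint wf_clo (c : clo) : bool :=
  let: Clo M s := c in bounded_term (size s).+1 M && all wf_clo s.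

Definition close (V : value) (s : seq clo) : clo :=
  match V with
  | Var x => nth (Clo (Ret (Var 0)) [::]) s x
  | Lam M => Clo M s
  end.

Definition uterm (M : term) (s : seq clo) : term := subst_term (env (map uclo s)) M.

Definition ustack (K : seq (term * seq clo)) : seq term :=
  [seq subst_term (up_subst (env (map uclo F.2))) F.1 | F <- K].

Definition wf_stack (K : seq (term * seq clo)) : bool :=
  all (fun F => bounded_term (size F.2).+1 F.1 && all wf_clo F.2) K.

Lemma uclo_close (V : value) (s : seq clo) :
  uclo (close V s) = subst_value (env (map uclo s)) V.
Proof.
case: V => [x|M] //=; rewrite /env; have [lt|ge] := ltnP x (size s).
  by rewrite (nth_map (Clo (Ret (Var 0)) [::])).
(* Out of range, the default closure unfolds to the default value of [env]. *)
by rewrite !nth_default ?size_map.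
Qed.

Lemma wf_close (V : value) (s : seq clo) :
  bounded_value (size s) V -> all wf_clo s -> wf_clo (close V s).
Proof.
case: V => [x|M] /= bV ws; last by rewrite bV.
by rewrite (all_nthP _ ws).
Qed.

(** The point of delaying substitutions: a step pushes a closure on an environment and leaves the
    code [P] unchanged. *)
Lemma subst0_uclo (V : value) (s : seq clo) (P : term) (r : seq clo) :
  subst0 (subst_value (env (map uclo s)) V) (subst_term (up_subst (env (map uclo r))) P)
  = uterm P (close V s :: r).
Proof.
rewrite subst0_up -uclo_close /uterm; congr subst_term.
by apply: funext => -[].
Qed.

(** * Subject expansion *)

(** Expansion has to invent types, and [T_Var] and [T_Bang] accept only well-formed ones; hence
    these invariants travel with every configuration. *)
Definition wf_ctx (G : ctx) : Prop := forall x, wf_inter (G x).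

Definition wf_dist (a : tydist) : bool :=
  all (fun pm => unit_coef pm.1 && wf_inter pm.2) a && (\sum_(pm <- a) pm.1 <= 1).

Fixpoint cty (c : clo) (A : arrow) (w : rat) {struct c} : Prop :=
  let: Clo M s := c in
  exists G w1 w2,
    [/\ wf_ctx G, ty_arrow G w1 (Lam M) A, wenv cty s G w2 & w = w1 + w2].

(** The premises of [T_Let] on the body, one for each entry of [a]; [G], [b] and [e] collect their
    contributions to the conclusion. *)
Fixpoint frame_ty (P : term) (a : tydist) (G : ctx) (b : tydist) (e : rat) : Prop :=
  match a with
  | [::] => [/\ G = ctx0, b = [::] & e = 0]
  | (p, m) :: a' => exists D w c G' b' e',
      [/\ ty_dist (ctx_cons m D) w P c, frame_ty P a' G' b' e',
          G = ctx_add (ctx_scale p D) G', b = scale p c ++ b' & e = p * w + e']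
  end.

(* As in [accepts], [e] leaves out the weight 1 of each let in [K]. *)
Fixpoint stack_ty (K : seq (term * seq clo)) (a : tydist) (e : rat) : Prop :=
  match K with
  | [::] => a = [::] /\ e = 0
  | (P, s) :: K' => exists G b e1 e2 e3,
      [/\ frame_ty P a G b e1, wf_ctx G /\ wf_dist b, wenv cty s G e2,
          stack_ty K' b e3 & e = e1 + e2 + e3]
  end.

(** The empty stack accepts only the empty type distribution, so a whole configuration is typed by
    [0]. *)
Definition config_ty (M : term) (s : seq clo) (K : seq (term * seq clo)) (w : rat) : Prop :=
  exists G a w1 w2 e,
    [/\ wf_ctx G /\ wf_dist a, ty_dist G w1 M a, wenv cty s G w2, stack_ty K a e
      & w = w1 + w2 + (size K)%:R + e].

Lemma unit_coefM (u q : rat) : unit_coef u -> unit_coef q -> unit_coef (u * q).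
Proof.
by move=> /andP[u0 u1] /andP[q0 q1]; rewrite /unit_coef mulr_gt0 //= mulr_ile1 // ltW.
Qed.

Lemma scaleM (T : Type) (u v : rat) (s : wseq T) : scale (u * v) s = scale u (scale v s).
Proof. by rewrite /scale -map_comp; apply: eq_map => x /=; rewrite mulrA. Qed.

Lemma scale1 (T : Type) (s : wseq T) : scale 1 s = s.
Proof. by rewrite /scale -[RHS]map_id; apply: eq_map => -[q A] /=; rewrite mul1r. Qed.

Lemma wf_inter_scale (u : rat) (m : inter) :
  unit_coef u -> wf_inter m -> wf_inter (scale u m).
Proof.
move=> hu; rewrite /wf_inter /scale all_map; apply: sub_all => x /= /andP[hq ->].
by rewrite unit_coefM.
Qed.

Lemma wf_inter_cat (s t : inter) : wf_inter (s ++ t) = wf_inter s && wf_inter t.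
Proof. exact: all_cat. Qed.

Lemma wf_ctx_add (G D : ctx) : wf_ctx G -> wf_ctx D -> wf_ctx (ctx_add G D).
Proof. by move=> hG hD x; rewrite wf_inter_cat hG hD. Qed.

Lemma wf_ctx_scale (u : rat) (G : ctx) : unit_coef u -> wf_ctx G -> wf_ctx (ctx_scale u G).
Proof. by move=> hu hG x; apply: wf_inter_scale. Qed.

Lemma wf_ctx_sum (n : nat) (D : 'I_n -> ctx) : (forall k, wf_ctx (D k)) -> wf_ctx (ctx_sum D).
Proof.
move=> h x; rewrite /ctx_sum; elim/big_ind: _ => [//|s t hs ht|k _]; last exact: h.
by rewrite wf_inter_cat hs ht.
Qed.

Lemma wf_dist_half (a b : tydist) :
  wf_dist a -> wf_dist b -> wf_dist (scale 2^-1 a ++ scale 2^-1 b).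
Proof.
move=> /andP[wa sa] /andP[wb sb]; apply/andP; split.
  rewrite all_cat; apply/andP; split; rewrite all_map.
    by apply: sub_all wa => x /= /andP[hq ->]; rewrite unit_coefM.
  by apply: sub_all wb => x /= /andP[hq ->]; rewrite unit_coefM.
by rewrite big_cat /scale !big_map /= -!mulr_sumr; lra.
Qed.

Lemma wf_Arr (m : inter) (a : tydist) : wf_inter m -> wf_dist a -> wf_arrow (Arr m a).
Proof.
move=> wm /andP[wa sa] /=; rewrite sa andbT; apply/andP; split.
  by apply: sub_all wm => -[].
apply: sub_all wa => -[p n] /= /andP[-> wn] /=.
by apply: sub_all wn => -[].
Qed.

(** * Lists as families indexed by ordinals *)

Lemma map_enum_nth (T : Type) (d : rat * T) (s : wseq T) :
  [seq ((nth d s i).1, (nth d s i).2) | i : 'I_(size s) <- enum 'I_(size s)] = s.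
Proof.
rewrite -[RHS](mkseq_nth d) /mkseq -val_enum_ord -map_comp.
by apply: eq_map => i /=; case: nth.
Qed.

Definition ord_cons (T : Type) (n : nat) (x : T) (f : 'I_n -> T) (k : 'I_n.+1) : T :=
  if unlift ord0 k is Some j then f j else x.

Lemma ord_cons0 (T : Type) (n : nat) (x : T) (f : 'I_n -> T) : ord_cons x f ord0 = x.
Proof. by rewrite /ord_cons unlift_none. Qed.

Lemma ord_consS (T : Type) (n : nat) (x : T) (f : 'I_n -> T) (k : 'I_n) :
  ord_cons x f (lift ord0 k) = f k.
Proof. by rewrite /ord_cons liftK. Qed.

Lemma ord_caseP (n : nat) (P : 'I_n.+1 -> Prop) :
  P ord0 -> (forall j, P (lift ord0 j)) -> forall k, P k.
Proof. by move=> h0 hS k; case: (unliftP ord0 k) => [j ->|->]. Qed.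

Lemma wsum_nth (T : Type) (R : T -> rat -> Prop) (d : rat * T) (s : wseq T) (w : rat) :
  wsum R s w ->
  exists2 ws : 'I_(size s) -> rat, forall i : 'I_(size s), R (nth d s i).2 (ws i)
    & w = \sum_(i < size s) (nth d s i).1 * ws i.
Proof.
elim: s w => [|[q A] s IH] w /=.
  by move=> ->; exists (fun=> 0); [case|rewrite big_ord0].
move=> [w1 [_ [hA /IH[ws hws ->] ->]]]; exists (ord_cons w1 ws).
  by apply: ord_caseP => [|j]; [rewrite ord_cons0|rewrite ord_consS; apply: hws].
rewrite big_ord_recl ord_cons0; congr (_ + _).
by apply: eq_bigr => k _; rewrite ord_consS.
Qed.

Lemma wenv_sum_intro (V : Type) (R : V -> arrow -> rat -> Prop) (s : seq V) (n : nat)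
    (D : 'I_n -> ctx) (ws : 'I_n -> rat) :
  (forall k, wenv R s (D k) (ws k)) -> wenv R s (ctx_sum D) (\sum_k ws k).
Proof.
elim: n D ws => [|n IH] D ws h.
  have -> : ctx_sum D = ctx0 by apply: funext => y; rewrite /ctx_sum big_ord0.
  by rewrite big_ord0; apply: wenv0.
have -> : ctx_sum D = ctx_add (D ord0) (ctx_sum (fun k => D (lift ord0 k))).
  by apply: funext => y; rewrite /ctx_sum big_ord_recl.
rewrite big_ord_recl; apply/wenv_add; exists (ws ord0), (\sum_k ws (lift ord0 k)).
by split=> //; apply: IH.
Qed.

(** Stands in for anti-substitution. A variable leaves all the weight to the environment; for an
    abstraction, the derivations for the components of [m] are gathered by [T_Bang]. *)
Lemma close_ty (V : value) (s : seq clo) (m : inter) (u : rat) :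
  bounded_value (size s) V -> wf_inter m -> wsum (cty (close V s)) m u ->
  exists G w1 w2, [/\ wf_ctx G, ty_inter G w1 V m, wenv cty s G w2 & u = w1 + w2].
Proof.
case: V => [x|Q] /= bV wm hu.
  exists (ctx1 x m), 0, u; rewrite add0r; split=> //.
  - by move=> y; rewrite /ctx1; case: eqP.
  - exact: T_Var.
  - exact: wenv_var_inv hu.
pose d := (0 : rat, Arr [::] [::]).
have [ws /choice[G /choice[w1 /choice[w2 h]]] ->] := wsum_nth d hu.
have hq (i : 'I_(size m)) : unit_coef (nth d m i).1.
  by have /andP[] := all_nthP d wm i (ltn_ord i).
exists (ctx_sum (fun i : 'I_(size m) => ctx_scale (nth d m i).1 (G i))),
  (\sum_(i < size m) (nth d m i).1 * w1 i), (\sum_(i < size m) (nth d m i).1 * w2 i); split.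
- by apply: wf_ctx_sum => i; apply: wf_ctx_scale => //; case: (h i).
- rewrite -[X in ty_inter _ _ _ X](map_enum_nth d m).
  by apply: T_Bang => // i; case: (h i).
- by apply: wenv_sum_intro => i; apply/wenv_scale; exists (w2 i) => //; case: (h i).
- rewrite -big_split; apply: eq_bigr => i _ /=.
  by case: (h i) => _ _ _ ->; rewrite mulrDr.
Qed.

(** * Linearity of stack typings *)

Lemma frame_ty_scale (u : rat) (P : term) (a b : tydist) (G : ctx) (e : rat) :
  frame_ty P a G b e -> frame_ty P (scale u a) (ctx_scale u G) (scale u b) (u * e).
Proof.
elim: a G b e => [|[p m] a IH] G b e /=.
  by move=> [-> -> ->]; rewrite mulr0.
move=> [D [w [c [G' [b' [e' [hD /IH h -> -> ->]]]]]]].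
exists D, w, c, (ctx_scale u G'), (scale u b'), (u * e'); split=> //.
- by apply: funext => y; rewrite /ctx_scale /ctx_add {1}/scale map_cat scaleM.
- by rewrite {1}/scale map_cat scaleM.
- by rewrite mulrDr mulrA.
Qed.

Lemma frame_ty_cat (P : term) (a1 a2 b1 b2 : tydist) (G1 G2 : ctx) (e1 e2 : rat) :
  frame_ty P a1 G1 b1 e1 -> frame_ty P a2 G2 b2 e2 ->
  frame_ty P (a1 ++ a2) (ctx_add G1 G2) (b1 ++ b2) (e1 + e2).
Proof.
move=> h1 h2; elim: a1 G1 b1 e1 h1 => [|[p m] a IH] G b e /=.
  by move=> [-> -> ->]; rewrite add0r.
move=> [D [w [c [G' [b' [e' [hD /IH h -> -> ->]]]]]]].
exists D, w, c, (ctx_add G' G2), (b' ++ b2), (e' + e2); split=> //.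
- by apply: funext => y; rewrite /ctx_add catA.
- by rewrite catA.
- by rewrite addrA.
Qed.

(** Both branches of a choice run under the same stack. Its two typings average because every
    ingredient is linear in the incoming type distribution. *)
Lemma stack_ty_half (K : seq (term * seq clo)) (a1 a2 : tydist) (e1 e2 : rat) :
  stack_ty K a1 e1 -> stack_ty K a2 e2 ->
  stack_ty K (scale 2^-1 a1 ++ scale 2^-1 a2) (2^-1 * e1 + 2^-1 * e2).
Proof.
elim: K a1 a2 e1 e2 => [|[P s] K IH] a1 a2 e1 e2 /=.
  by move=> [-> ->] [-> ->]; rewrite mulr0 addr0.
move=> [G1 [b1 [x1 [y1 [z1 [f1 [wG1 wb1] g1 k1 ->]]]]]].
move=> [G2 [b2 [x2 [y2 [z2 [f2 [wG2 wb2] g2 k2 ->]]]]]].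
exists (ctx_add (ctx_scale 2^-1 G1) (ctx_scale 2^-1 G2)),
  (scale 2^-1 b1 ++ scale 2^-1 b2), (2^-1 * x1 + 2^-1 * x2),
  (2^-1 * y1 + 2^-1 * y2), (2^-1 * z1 + 2^-1 * z2); split; last ring.
- by apply: frame_ty_cat; apply: frame_ty_scale.
- by split; [apply: wf_ctx_add; apply: wf_ctx_scale|apply: wf_dist_half].
- apply/wenv_add; exists (2^-1 * y1), (2^-1 * y2).
  by split=> //; apply/wenv_scale; [exists y1|exists y2].
- exact: IH.
Qed.

Lemma stack_ty0 (K : seq (term * seq clo)) : stack_ty K [::] 0.
Proof.
elim: K => [|[P s] K IH] //=.
exists ctx0, [::], 0, 0, 0; rewrite !addr0; split=> //; last exact: wenv0.
by rewrite /wf_dist /= big_nil.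
Qed.

Lemma config_ty0 (M : term) (s : seq clo) (K : seq (term * seq clo)) :
  config_ty M s K (size K)%:R.
Proof.
exists ctx0, [::], 0, 0, 0; rewrite !addr0 add0r; split=> //.
- by rewrite /wf_dist /= big_nil.
- exact: T_Zero.
- exact: wenv0.
- exact: stack_ty0.
Qed.

(** Reindexes the list-based [frame_ty] by ordinals, as [T_Let] demands. *)
Lemma ty_let_frame (G D : ctx) (v e : rat) (N P : term) (a b : tydist) :
  ty_dist G v N a -> frame_ty P a D b e -> ty_dist (ctx_add G D) (e + v + 1) (Let N P) b.
Proof.
pose d := (0 : rat, [::] : inter).
have frameP (a' : tydist) D' b' e' : frame_ty P a' D' b' e' ->
    exists (F : 'I_(size a') -> ctx) (w : 'I_(size a') -> rat) (c : 'I_(size a') -> tydist),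
    [/\ forall k : 'I_(size a'), ty_dist (ctx_cons (nth d a' k).2 (F k)) (w k) P (c k),
        D' = ctx_sum (fun k : 'I_(size a') => ctx_scale (nth d a' k).1 (F k)),
        b' = \big[cat/[::]]_(k < size a') scale (nth d a' k).1 (c k)
      & e' = \sum_(k < size a') (nth d a' k).1 * w k].
  elim: a' D' b' e' => [|[p m] a' IH] D' b' e' /=.
    move=> [-> -> ->]; exists (fun=> ctx0), (fun=> 0), (fun=> [::]).
    by rewrite !big_ord0; split=> [[]|||] //; apply: funext => y; rewrite /ctx_sum big_ord0.
  move=> [E [w [c [G' [b1 [e1 [hE /IH[F [ws [cs [hF -> -> ->]]]] -> -> ->]]]]]]].
  exists (ord_cons E F), (ord_cons w ws), (ord_cons c cs); split.
  - by apply: ord_caseP => [|j]; [rewrite !ord_cons0|rewrite !ord_consS; apply: hF].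
  - apply: funext => y; rewrite /ctx_sum big_ord_recl ord_cons0; congr (_ ++ _).
    by apply: eq_bigr => k _; rewrite ord_consS.
  - by rewrite big_ord_recl ord_cons0; congr (_ ++ _); apply: eq_bigr => k _; rewrite ord_consS.
  - by rewrite big_ord_recl ord_cons0; congr (_ + _); apply: eq_bigr => k _; rewrite ord_consS.
move=> hN /frameP[F [w [c [hF -> -> ->]]]].
apply: T_Let hF.
by rewrite map_enum_nth.
Qed.

(** Focusing on [N] is no reduction step and keeps the weight: the unit of [T_Let] replaces the one
    counted for the pushed frame. *)
Lemma config_ty_let (N P : term) (s : seq clo) (K : seq (term * seq clo)) (w : rat) :
  config_ty N s ((P, s) :: K) w -> config_ty (Let N P) s K w.
Proof.
move=> [G [a [w1 [w2 [_ [[wG wa] hN hs [D [b [e1 [e2 [e3 [hf [wD wb] hD hK ->]]]]]] ->]]]]]].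
exists (ctx_add G D), b, (e1 + w1 + 1), (w2 + e2), e3; split=> //.
- by split=> //; apply: wf_ctx_add.
- exact: ty_let_frame hN hf.
- by apply/wenv_add; exists w2, e2.
- by rewrite /= -addn1 natrD; ring.
Qed.

(** Expansion of a let step. The type [G 0] of the bound variable becomes that of [V], returned with
    probability 1; the new unit is that of the restored frame. *)
Lemma config_ty_ret (V : value) (s : seq clo) (P : term) (r : seq clo)
    (K : seq (term * seq clo)) (w : rat) :
  bounded_value (size s) V ->
  config_ty P (close V s :: r) K w -> config_ty (Ret V) s ((P, r) :: K) (1 + w).
Proof.
move=> bV [G [a [w1 [_ [e [[wG wa] hP [u [w2 [hu hr ->]]] hK ->]]]]]].
have [D [v1 [v2 [wD hV hs ->]]]] := close_ty bV (wG 0%N) hu.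
exists D, [:: (1, G 0%N)], v1, v2, (w1 + w2 + e); split.
- by split=> //; rewrite /wf_dist /= wG big_cons big_nil.
- exact: T_Val.
- by [].
- exists (fun x => G x.+1), a, w1, w2, e; split=> //; last by split=> // x; apply: wG.
  exists (fun x => G x.+1), w1, a, ctx0, [::], 0; split=> //.
  + suff -> : ctx_cons (G 0%N) (fun x => G x.+1) = G by [].
    by apply: funext => -[].
  + by apply: funext => y; rewrite /ctx_add /ctx_scale scale1 cats0.
  + by rewrite scale1 cats0.
  + by rewrite mul1r addr0.
- by rewrite /= -addn1 natrD; ring.
Qed.

Lemma config_ty_app (V W : value) (s : seq clo) (P : term) (r : seq clo)
    (K : seq (term * seq clo)) (w : rat) :
  bounded_value (size s) V -> bounded_value (size s) W -> close V s = Clo P r ->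
  config_ty P (close W s :: r) K w -> config_ty (App V W) s K (1 + w).
Proof.
move=> bV bW cV [G [a [w1 [_ [e [[wG wa] hP [u [w2 [hu hr ->]]] hK ->]]]]]].
have [D [v1 [v2 [wD hW hs ->]]]] := close_ty bW (wG 0%N) hu.
(* The function closure receives the arrow read off from its body, with the new unit from [T_Lam];
   [close_ty] then also covers a function given by a variable. *)
have hA : wsum (cty (close V s)) [:: (1, Arr (G 0%N) a)] (w1 + 1 + w2).
  exists (w1 + 1 + w2), 0; split=> //; last by rewrite mul1r addr0.
  rewrite cV; exists (fun x => G x.+1), (w1 + 1), w2; split=> //.
  apply: T_Lam; suff -> : ctx_cons (G 0%N) (fun x => G x.+1) = G by [].
  by apply: funext => -[].
have wA : wf_inter [:: (1, Arr (G 0%N) a)].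
  by rewrite /wf_inter all_seq1 (wf_Arr (wG 0%N) wa).
have [E [x1 [x2 [wE hV hs' eqw]]]] := close_ty bV wA hA.
exists (ctx_add E D), a, (x1 + v1), (x2 + v2), e; split=> //.
- by split=> //; apply: wf_ctx_add.
- exact: T_App hV hW.
- by apply/wenv_add; exists x2, v2.
- by lra.
Qed.

Lemma config_ty_oplus (M N : term) (s : seq clo) (K : seq (term * seq clo)) (w v : rat) :
  config_ty M s K w -> config_ty N s K v ->
  config_ty (Oplus M N) s K (1 + 2^-1 * w + 2^-1 * v).
Proof.
move=> [G1 [a1 [x1 [y1 [z1 [[wG1 wa1] hM hs1 hK1 ->]]]]]].
move=> [G2 [a2 [x2 [y2 [z2 [[wG2 wa2] hN hs2 hK2 ->]]]]]].
exists (ctx_add (ctx_scale 2^-1 G1) (ctx_scale 2^-1 G2)),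
  (scale 2^-1 a1 ++ scale 2^-1 a2), (2^-1 * x1 + 2^-1 * x2 + 1),
  (2^-1 * y1 + 2^-1 * y2), (2^-1 * z1 + 2^-1 * z2); split.
- by split; [apply: wf_ctx_add; apply: wf_ctx_scale|apply: wf_dist_half].
- exact: T_Oplus.
- apply/wenv_add; exists (2^-1 * y1), (2^-1 * y2).
  by split=> //; apply/wenv_scale; [exists y1|exists y2].
- exact: stack_ty_half.
- by lra.
Qed.

(** Induction on [k], then on [M] for the lets, where the focus moves into [N] without a step. The
    bound is an inequality: at [k = 0] the trivial typing already has weight [size K]. *)
Lemma config_complete (k : nat) (M : term) (s : seq clo) (K : seq (term * seq clo)) :
  bounded_term (size s) M -> all wf_clo s -> wf_stack K ->
  exists2 w, config_ty M s K w & Ek k (plug (ustack K) (uterm M s)) <= w.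
Proof.
(* Settles [k = 0] and a value under the empty stack, where [Ek] vanishes. *)
have triv M' s' K' : exists2 w, config_ty M' s' K' w & 0 <= w.
  by exists (size K')%:R; [apply: config_ty0|apply: ler0n].
elim: k M s K => [|k IHk] M s K; first by move=> *; rewrite Ek0.
elim: M s K => [V|V W|M _ N _|N IHN P _] s K /=.
- move=> bV ws; case: K => [_|[P r] K]; first by rewrite Ek_Ret.
  rewrite /wf_stack /= => /andP[/andP[bP wr] wK].
  have [|||w hw le] := IHk P (close V s :: r) K; rewrite //= ?wf_close //.
  exists (1 + w); first exact: config_ty_ret.
  rewrite (@Ek_plug1 _ _ _ (uterm P (close V s :: r))) ?lerD2l //.
  by rewrite /= subst0_uclo.
- move=> /andP[bV bW] ws wK; case cV: (close V s) => [P r].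
  have /= := wf_close bV ws; rewrite cV /= => /andP[bP wr].
  have [|||w hw le] := IHk P (close W s :: r) K; rewrite //= ?wf_close //.
  exists (1 + w); first exact: config_ty_app cV hw.
  rewrite (@Ek_plug1 _ _ _ (uterm P (close W s :: r))) ?lerD2l //.
  by rewrite /= -uclo_close cV /= subst0_uclo.
- move=> /andP[bM bN] ws wK.
  have [w hw lew] := IHk M s K bM ws wK.
  have [v hv lev] := IHk N s K bN ws wK.
  exists (1 + 2^-1 * w + 2^-1 * v); first exact: config_ty_oplus.
  by rewrite (Ek_plug2 k _ (uterm M s) (uterm N s)); lra.
- move=> /andP[bN bP] ws wK.
  have [|w hw le] := IHN s ((P, s) :: K) bN ws; first by rewrite /wf_stack /= bP ws.
  by exists w => //; apply: config_ty_let.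
Qed.

(** * The two bounds for closed terms *)

Lemma weight_le_Ek (M : term) (w : rat) :
  closed_term M -> ty_dist ctx0 w M [::] -> exists k, w <= Ek k M.
Proof.
move=> cM hw; have [k] := ty_sound.2.2 _ _ _ _ hw [::] 0 (wenv0 _ _) [::] 0 erefl.
by rewrite subst_closed // !addr0; exists k.
Qed.

Lemma Ek_le_weight (M : term) (k : nat) :
  closed_term M -> exists2 w, ty_dist ctx0 w M [::] & Ek k M <= w.
Proof.
move=> cM; have [w hw] := @config_complete k M [::] [::] cM isT isT.
rewrite /uterm subst_closed // => le.
(* The empty environment forces [G] to be [ctx0], the empty stack forces [a] to be empty, and only
   the weight [w1] remains. *)
move: hw => [G [a [w1 [w2 [e [_ hM [G0 w20] [a0 e0] wE]]]]]].
exists w1; last by move: le; rewrite wE w20 e0 !addr0.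
by move: hM; rewrite a0 (_ : G = ctx0) //; apply: funext.
Qed.

Theorem mainTheorem14 (R : realType) (M : term) (hM : closed_term M) :
  expected_time R M = weight_sup R M
  /\ (PAST R M <-> (weight_sup R M < +oo)%E).
Proof.
suff E : expected_time R M = weight_sup R M by rewrite /PAST E.
(* Each element of either set lies below an element of the other. *)
apply/le_anti/andP; split.
- apply: ge_ereal_sup => _ [k _ <-].
  have [w hw le] := Ek_le_weight k hM.
  apply: le_trans (ereal_sup_ubound _) ; last by exists w.
  by rewrite lee_fin ler_rat.
- apply: ge_ereal_sup => _ [w hw <-].
  have [k le] := weight_le_Ek hM hw.
  apply: le_trans (ereal_sup_ubound _) ; last by exists k.
  by rewrite lee_fin ler_rat.
Qed.
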